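(* Let $G$ be a bipartite graph with respect to the finite lists of distinct vertices $\sigma$ (offline side) and $\pi$ (online side, in arrival order), and let $V$ be the set of elements of $\sigma$. Let $M$ be a maximum cardinality matching with respect to $G$, with $|M|\ge 1$. Then $$1-\Bigl(1-\frac{1}{|M|+1}\Bigr)^{|M|}\;\le\;\frac{\mathbb{E}_{R\sim \mathrm{RANKING}(G,\pi)}\bigl[|R|\bigr]}{|M|}.$$
   Context: An edge is a set of exactly two vertices; a graph $G$ is a set of edges; $\mathcal V(G)=\bigcup_{e\in G}e$ and $N_G(v)=\{u\mid\{v,u\}\in G\}$. $G$ is bipartite with respect to two vertex sets $A,B$ (or lists, identified with their sets of elements) if $\mathcal V(G)\subseteq A\cup B$ and no edge of $G$ is contained in $A$ or in $B$. A matching is a set of pairwise disjoint edges; a matching with respect to $G$ is a matching that is a subset of $G$; it is a maximum cardinality matching with respect to $G$ if no matching with respect to $G$ has larger cardinality. For a list $\sigma$ of distinct elements, $\sigma(v)$ is the rank (position, starting at 1) of $v$ in $\sigma$. A permutation of a finite set is a list of distinct elements whose elements are exactly those of the set; $\mathcal S(V)$ is the set of permutations of $V$. The procedure online-match$(G,\pi,\tau)$, for $\tau$ a permutation of $V$: start with $R=\emptyset$; process the vertices $u$ of $\pi$ in order; if $N_G(u)\setminus\mathcal V(R)\neq\emptyset$, add to $R$ the edge $\{v,u\}$, where $v$ is the vertex of $N_G(u)\setminus\mathcal V(R)$ with minimum rank $\tau(v)$; otherwise leave $R$ unchanged. The output is the final $R$. $\mathrm{RANKING}(G,\pi)$ is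 the probability distribution of online-match$(G,\pi,\tau)$ when $\tau$ is drawn uniformly at random from $\mathcal S(V)$. *)

(* Defs.v *)
From mathcomp Require Import all_boot all_order all_algebra.
From mathcomp Require Import finmap.

Set Implicit Arguments.
Unset Strict Implicit.
Unset Printing Implicit Defensive.

Import Order.TTheory GRing.Theory Num.Theory.

Local Open Scope fset_scope.

Section Graphs.
Variable T : choiceType.
Implicit Types (G M : {fset {fset T}}) (e : {fset T}) (u v : T).

(* The vertex set of G is [fcover G], the union of its edges. *)
Definition is_edge e : bool := #|` e| == 2.

Definition is_graph G : Prop := forall e, e \in G -> is_edge e.

Definition neighbours G v : {fset T} :=
  [fset u in fcover G | [fset v; u] \in G].

(* A and B need not be disjoint: the last two conditions force every vertex
   lying in both of them to be isolated. *)
Definition bipartite G (A B : {fset T}) : Prop :=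
  [/\ fcover G `<=` A `|` B,
      forall e, e \in G -> ~~ (e `<=` A)
    & forall e, e \in G -> ~~ (e `<=` B)].

Definition matching M : Prop := is_graph M /\ trivIfset M.

Definition matching_in G M : Prop := matching M /\ M `<=` G.

Definition max_card_matching G M : Prop :=
  matching_in G M /\ forall M', matching_in G M' -> #|` M'| <= #|` M|.

End Graphs.

Section Ranking.
Variable T : choiceType.
Implicit Types (G R : {fset {fset T}}) (V : {fset T}) (s pi tau : seq T).

Definition rank s (v : T) : nat := (index v s).+1.

Definition perms V : {fset seq T} := [fset tau in permutations V].

(* The [pick] returns None exactly when there is no free neighbour; when all
   the free neighbours occur in tau, the one of minimum rank is unique. *)
Definition match_step G tau R (u : T) : {fset {fset T}} :=
  let free := neighbours G u `\` fcover R in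
  if [pick v : free | [forall w : free, rank tau (val v) <= rank tau (val w)]]
    is Some v then [fset val v; u] |` R else R.

Definition online_match G pi tau : {fset {fset T}} :=
  foldl (match_step G tau) fset0 pi.

End Ranking.

Local Open Scope ring_scope.

Section Distributions.
Variable F : realFieldType.

(* Probability mass functions are finitely supported functions. *)
Definition expectation (X : choiceType) (P : {fsfun X -> F with 0})
    (f : X -> F) : F :=
  \sum_(x <- finsupp P) P x * f x.

(* The law of the output for tau uniform in [perms V]: R has probability
   #{tau | online_match G pi tau = R} / #(perms V). *)
Definition RANKING (T : choiceType) (V : {fset T}) (G : {fset {fset T}})
    (pi : seq T) : {fsfun {fset {fset T}} -> F with 0} :=
  [fsfun R in [fset online_match G pi tau | tau in perms V] =>
     #|` [fset tau in perms V | online_match G pi tau == R]|%:R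
       / #|` perms V|%:R].

End Distributions.

(* Main.v *)
Require Import Defs.
From mathcomp Require Import all_boot all_order all_algebra.
From mathcomp Require Import finmap.
From mathcomp Require Import zify ring lra.

(* Following Birnbaum and Mathieu. Fix an edge {v, u} of M with v offline, and a
   position t. If v is unmatched after being moved to position t in tau, then u
   is matched under tau itself to a vertex of index at most t. Summing over tau
   and over the edges of M, and using that every permutation with v at position
   t arises from exactly m = |sigma| permutations tau, gives, for S t the
   expected number of matched offline vertices among the first t,
     |M| + m * S t <= (m + 1) * S (t + 1).
   Hence E|R| >= S m >= |M| * (1 - (1 - 1/(m+1))^m). No reduction to graphs with
   a perfect matching is needed: since m >= |M| and (1 - 1/(k+1))^k is
   nonincreasing in k, this is at least the bound with m replaced by |M|. *)

Import Order.TTheory GRing.Theory Num.Theory.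
Local Open Scope fset_scope.
Local Open Scope ring_scope.

(** * Moving one element of a list to a given position *)

Section Insertion.

Set Implicit Arguments.
Unset Strict Implicit.
Local Open Scope nat_scope.
Variable T : eqType.
Implicit Types (s : seq T) (v x : T).

Definition insert v t s := take t s ++ v :: drop t s.

(** Positions are indices counted from 0, so index [t] means rank [t + 1]. *)
Definition move v t s := insert v t (rem v s).

Lemma perm_insert v t s : perm_eq (insert v t s) (v :: s).
Proof. by rewrite /insert -cat1s perm_catCA cat_take_drop. Qed.

Lemma perm_move v t s : v \in s -> perm_eq (move v t s) s.
Proof.
move=> vs; rewrite (perm_trans (perm_insert _ _ _)) // perm_sym.
exact: perm_to_rem.
Qed.

Lemma index_insert v x t s :
  x != v -> t <= size s -> index x (insert v t s) = bump t (index x s).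
Proof.
move=> xv ts; rewrite -{2}(cat_take_drop t s) !index_cat /=.
case: ifP => [xt|_].
  have : index x (take t s) < size (take t s) by rewrite index_mem.
  by rewrite size_takel // => it; rewrite /bump leqNgt it.
by rewrite eq_sym (negPf xv) size_takel // /bump leq_addr addnS.
Qed.

Lemma index_insert_self v t s :
  v \notin s -> t <= size s -> index v (insert v t s) = t.
Proof.
move=> vs ts; rewrite index_cat /= eqxx addn0 size_takel //.
by case: ifP => // /mem_take; rewrite (negPf vs).
Qed.

Lemma rem_insert v t s : v \notin s -> rem v (insert v t s) = s.
Proof.
move=> vs; rewrite remE index_cat /= eqxx.
have /negPf -> : v \notin take t s by apply: contra vs; apply: mem_take.
rewrite addn0 take_size_cat // -[(size _).+1]addn1 drop_cat.
by rewrite ltnNge leq_addr /= addKn drop1 /= cat_take_drop.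
Qed.

Lemma insert_rem v s : v \in s -> insert v (index v s) (rem v s) = s.
Proof.
move=> vs; have sz : size (take (index v s) s) = index v s.
  by rewrite size_takel // index_size.
rewrite remE /insert -{1 4}sz take_size_cat // drop_size_cat //.
rewrite -[RHS](cat_take_drop (index v s)); congr (_ ++ _).
by rewrite [RHS](drop_nth v) ?index_mem // nth_index.
Qed.

Section Move.
Variables (v : T) (t : nat) (s : seq T).
Hypotheses (s_uniq : uniq s) (vs : v \in s) (ts : t < size s).

Let v_rem : v \notin rem v s.
Proof. by rewrite mem_rem_uniq // inE eqxx. Qed.

Let size_rem_s : size s = (size (rem v s)).+1.
Proof. by rewrite size_rem // prednK // (leq_ltn_trans _ ts). Qed.

Lemma index_move_self : index v (move v t s) = t.
Proof. by rewrite index_insert_self // -ltnS -size_rem_s. Qed.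

Lemma move_move : move v (index v s) (move v t s) = s.
Proof. by rewrite {1}/move rem_insert // insert_rem. Qed.

Lemma index_move x : x != v ->
  index x (move v t s) = bump t (index x (rem v s)).
Proof. by move=> xv; rewrite index_insert // -ltnS -size_rem_s. Qed.

Lemma index_bump_rem x : x != v ->
  index x s = bump (index v s) (index x (rem v s)).
Proof.
move=> xv; rewrite -{1}(insert_rem vs) index_insert //.
by rewrite -ltnS -size_rem_s index_mem.
Qed.

(** Both orders come from the one in [rem v s] through some [bump], which is strictly increasing. *)
Lemma leq_index_move x y : x != v -> y != v ->
  (index x (move v t s) <= index y (move v t s)) = (index x s <= index y s).
Proof.
move=> xv yv.
by rewrite !index_move // (index_bump_rem xv) (index_bump_rem yv) !leq_bump2.
Qed.

(** Since [v] itself occupies [t], such an [x] has index below [t] in [rem v s], and putting [v]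
    back shifts it by at most one. *)
Lemma index_before_move x : x != v -> index x (move v t s) <= t -> index x s <= t.
Proof.
move=> xv; rewrite index_move // (index_bump_rem xv) /bump; lia.
Qed.

End Move.
End Insertion.

(** * Counting lists up to a move of one element *)

Section Counting.

Set Implicit Arguments.
Local Open Scope nat_scope.
Variable T : eqType.

Lemma leq_count_subset (a : pred T) s1 s2 :
  uniq s1 -> {subset s1 <= s2} -> count a s1 <= count a s2.
Proof.
move=> u1 sub; rewrite -!size_filter uniq_leq_size ?filter_uniq // => x.
by rewrite !mem_filter => /andP[-> /sub].
Qed.

Lemma count_le1 (a : pred T) s :
  uniq s -> {in s &, forall x y, a x -> a y -> x = y} -> count a s <= 1.
Proof.
move=> us eq_a; rewrite -size_filter.
case E: (filter a s) => [|x [|y l]] //.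
have : uniq (filter a s) by rewrite filter_uniq.
have [] : x \in filter a s /\ y \in filter a s by rewrite E !inE !eqxx orbT.
rewrite !mem_filter => /andP[ax xs] /andP[ay ys].
by rewrite (eq_a _ _ xs ys ax ay) in E *; rewrite E /= inE eqxx.
Qed.

(* A permutation is determined by the result of moving v to position t,
   together with the original position of v. *)
Lemma count_move (P : seq (seq T)) (a : pred (seq T)) v t m :
  uniq P ->
  (forall s s', s \in P -> perm_eq s' s -> s' \in P) ->
  {in P, forall s, [/\ uniq s, v \in s & size s = m]} -> t < m ->
  count (a \o move v t) P <= m * count (fun s => (index v s == t) && a s) P.
Proof.
move=> uP closedP propP tm.
pose f s := (move v t s, index v s).
pose s1 := [seq f s | s <- P & a (move v t s)].
pose s2 := [seq (s, i) | s <- [seq s <- P | (index v s == t) && a s], i <- iota 0 m].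
have -> : count (a \o move v t) P = size s1 by rewrite size_map size_filter.
have -> : m * count (fun s => (index v s == t) && a s) P = size s2.
  by rewrite size_allpairs size_filter size_iota mulnC.
apply: uniq_leq_size.
  rewrite map_inj_in_uniq ?filter_uniq // => x y.
  rewrite !mem_filter => /andP[_ xP] /andP[_ yP] [e1 e2].
  have [ux vx sx] := propP _ xP; have [uy vy sy] := propP _ yP.
  (* Moving [v] back to its recorded index recovers the list, so [f] is injective. *)
  by rewrite -(@move_move _ v t x) // e1 e2 move_move.
move=> x /mapP[s + ->]; rewrite mem_filter => /andP[as_ sP].
have [us vs ss] := propP _ sP; apply/allpairsP; exists (f s); split=> //=.
  rewrite mem_filter index_move_self ?ss // eqxx as_ /=.
  by apply: closedP sP _; apply: perm_move.
by rewrite mem_iota add0n -ss index_mem.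
Qed.

End Counting.

(** * Edges, covers and single steps of the online matching *)

Section Matching.

Set Implicit Arguments.
Local Open Scope nat_scope.
Variable T : choiceType.
Implicit Types (G R : {fset {fset T}}) (tau : seq T).

Lemma fcoverP R x : reflect (exists2 e, e \in R & x \in e) (x \in fcover R).
Proof.
rewrite /fcover; apply: (iffP (bigfcupP _ _ _ _)) => -[e]; last by exists e; rewrite ?andbT.
by rewrite andbT; exists e.
Qed.

Lemma in_fcoverU1 R e x : (x \in fcover (e |` R)) = (x \in e) || (x \in fcover R).
Proof.
apply/fcoverP/orP => [[e' /fset1UP[->|e'R] xe']|[xe|/fcoverP[e' e'R xe']]].
- by left.
- by right; apply/fcoverP; exists e'.
- by exists e; rewrite ?fset1U1.
- by exists e'; rewrite ?fset1Ur.
Qed.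

Lemma fcoverS R R' : R `<=` R' -> fcover R `<=` fcover R'.
Proof.
move=> /fsubsetP sub; apply/fsubsetP => x /fcoverP[e /sub eR xe].
by apply/fcoverP; exists e.
Qed.

Lemma is_edgeP (e : {fset T}) : is_edge e -> exists x y, e = [fset x; y].
Proof.
rewrite /is_edge => e2; have /fset0Pn[x xe] : e != fset0.
  by rewrite -cardfs_gt0 (eqP e2).
move: e2; rewrite (cardfsD1 x) xe eqSS => /cardfs1P[y ey].
by exists x, y; rewrite -ey fsetD1K.
Qed.

Lemma mem_neighbours G u w : (w \in neighbours G u) = ([fset w; u] \in G).
Proof.
rewrite in_fset /= inE fsetUC andb_idl // => wG.
by apply/fcoverP; exists [fset w; u]; rewrite ?fset21.
Qed.

Lemma match_stepP G tau R u :
  (forall v, [fset v; u] \in G -> v \in fcover R) /\ match_step G tau R u = R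
  \/ exists v, [/\ [fset v; u] \in G, v \notin fcover R,
       forall w, [fset w; u] \in G -> w \notin fcover R ->
         index v tau <= index w tau
     & match_step G tau R u = [fset v; u] |` R].
Proof.
have in_free w : [fset w; u] \in G -> w \notin fcover R ->
    w \in neighbours G u `\` fcover R.
  by move=> wG wR; rewrite in_fsetD wR mem_neighbours.
rewrite /match_step; case: pickP => [v /forallP vmin|no_min].
  right; exists (val v); have := valP v; rewrite in_fsetD mem_neighbours => /andP[vR vG].
  split=> // w wG wR.
  by have := vmin [` in_free w wG wR]; rewrite /rank ltnS.
left; split=> // v vG; apply/negPn/negP => vR.
(* A free neighbour makes the type of free neighbours inhabited, so a minimiser of the rank exists
   and the pick cannot fail. *)
pose v0 := [` in_free v vG vR].
case: (@arg_minnP _ v0 xpredT (fun w => rank tau (val w)) isT) => w _ wmin.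
by have /forallP[] := no_min w => x; apply: wmin.
Qed.

Lemma match_step_subset G tau R u : R `<=` match_step G tau R u.
Proof.
by have [[_ ->]|[v [_ _ _ ->]]] := match_stepP G tau R u; rewrite ?fsubsetUr.
Qed.

Lemma foldl_match_subset G tau R s : R `<=` foldl (match_step G tau) R s.
Proof.
elim: s R => //= u s IHs R.
exact: fsubset_trans (match_step_subset _ _ _ _) (IHs _).
Qed.

Lemma online_match_ind (Q : {fset {fset T}} -> Prop) G pi tau :
  Q fset0 ->
  (forall R u v, u \in pi -> Q R -> [fset v; u] \in G -> v \notin fcover R ->
    Q ([fset v; u] |` R)) ->
  Q (online_match G pi tau).
Proof.
move=> Q0 Qstep; rewrite /online_match.
have : {subset pi <= pi} by [].
(* The induction runs over the vertices still to be processed, while membership in the full list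
   [pi] is kept. *)
elim: {1 3}pi fset0 Q0 => //= u s IHs R QR sub; apply: IHs; last first.
  by move=> x xs; rewrite sub // inE xs orbT.
have [[_ ->] //|[v [vG vR _ ->]]] := match_stepP G tau R u.
by apply: Qstep; rewrite ?sub ?mem_head.
Qed.

Lemma online_match_subset G pi tau : online_match G pi tau `<=` G.
Proof.
apply: (@online_match_ind (fun R => R `<=` G)) => [|R u v _ RG vG _]; first exact: fsub0set.
by rewrite fsubUset fsub1set vG.
Qed.

(** * Matchings across the two sides of a bipartite graph *)

Variables (G : {fset {fset T}}) (sigma pi : seq T).
Hypothesis G_graph : is_graph G.
Hypothesis G_bipartite : bipartite G [fset v in sigma] [fset u in pi].

Lemma edge_sides v u : [fset v; u] \in G -> u \in pi ->
  v \in sigma /\ v \notin pi.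
Proof.
case: G_bipartite => cov _ not_pi vG u_pi.
have v_pi : v \notin pi.
  apply: contra (not_pi _ vG) => v_pi; apply/fsubsetP => x.
  by rewrite !inE => /orP[]/eqP->.
have : v \in fcover G by apply/fcoverP; exists [fset v; u]; rewrite ?fset21.
by move=> /(fsubsetP cov); rewrite !inE (negPf v_pi) orbF.
Qed.

(** The boolean form of the body allows [xchoose] to orient every edge. *)
Lemma edge_ends e : e \in G ->
  exists p : T * T, [&& e == [fset p.1; p.2], p.1 \in sigma & p.2 \in pi].
Proof.
move=> eG; case: G_bipartite => cov not_sigma not_pi.
have [x [y eE]] := is_edgeP (G_graph eG).
have side z : z \in e -> (z \in sigma) || (z \in pi).
  move=> ze; have : z \in fcover G by apply/fcoverP; exists e.
  by move=> /(fsubsetP cov); rewrite !inE.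
have other (s : seq T) : ~~ (e `<=` [fset z in s]) -> (x \in s) && (y \in s) = false.
  move=> es; apply: contraNF es => /andP[xs ys]; rewrite eE.
  by apply/fsubsetP => z; rewrite !inE => /orP[]/eqP->.
have [xe ye] : x \in e /\ y \in e by rewrite eE fset21 fset22.
move: (other _ (not_sigma _ eG)) (other _ (not_pi _ eG)) (side _ xe) (side _ ye).
have [x_sigma|_] := boolP (x \in sigma) => /=.
  by move=> ->; exists (x, y); rewrite eE eqxx x_sigma.
move=> _ + x_pi; rewrite x_pi /= => ->; rewrite orbF => y_sigma.
by exists (y, x); rewrite eE fsetUC eqxx y_sigma.
Qed.

(** Edges of a matching are disjoint, so either end determines its edge; hence both projections of
    the list of oriented edges are duplicate-free. *)
Lemma matching_ends M : matching_in G M -> exists L : seq (T * T),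
  [/\ size L = #|` M|, uniq (unzip1 L), uniq (unzip2 L)
    & {in L, forall p, [/\ [fset p.1; p.2] \in G, p.1 \in sigma & p.2 \in pi]}].
Proof.
move=> [[_ /trivIfsetP disjM] /fsubsetP MG].
have ends (e : M) := edge_ends (MG _ (valP e)).
pose f e := xchoose (ends e).
have fP e : [&& val e == [fset (f e).1; (f e).2], (f e).1 \in sigma & (f e).2 \in pi].
  exact: xchooseP (ends e).
have same (e e' : M) x : x \in val e -> x \in val e' -> e = e'.
  move=> xe xe'; apply/val_inj/eqP/negPn/negP => ne.
  have /fdisjointP/(_ x xe) := disjM _ _ (valP e) (valP e') ne.
  by rewrite xe'.
exists [seq f e | e <- enum {: M}]; split.
- by rewrite size_map -cardE cardfE.
- rewrite /unzip1 -map_comp map_inj_uniq ?enum_uniq // => e e' /= ee'.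
  have /and3P[/eqP eE _ _] := fP e; have /and3P[/eqP eE' _ _] := fP e'.
  by apply: (same _ _ (f e).1); [rewrite eE fset21|rewrite eE' ee' fset21].
- rewrite /unzip2 -map_comp map_inj_uniq ?enum_uniq // => e e' /= ee'.
  have /and3P[/eqP eE _ _] := fP e; have /and3P[/eqP eE' _ _] := fP e'.
  by apply: (same _ _ (f e).2); [rewrite eE fset22|rewrite eE' ee' fset22].
- move=> p /mapP[e _ ->]; have /and3P[/eqP <- -> ->] := fP e.
  by rewrite MG // fsvalP.
Qed.

(** An edge is added only when its offline end is still uncovered, so an offline vertex never gets a
    second partner. *)
Lemma online_match_partner tau w u u' : u \in pi -> u' \in pi ->
  [fset w; u] \in online_match G pi tau ->
  [fset w; u'] \in online_match G pi tau -> u = u'.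
Proof.
pose Q R := forall w u u', w \notin pi -> u \in pi -> u' \in pi ->
  [fset w; u] \in R -> [fset w; u'] \in R -> u = u'.
have QR : Q (online_match G pi tau).
  apply: (@online_match_ind Q) => [? ? ? _ _ _ //|R u0 v u0_pi QR vG vR].
  have [_ v_pi] := edge_sides vG u0_pi.
  have inj w0 u1 : w0 \notin pi -> u1 \in pi ->
      [fset w0; u1] = [fset v; u0] -> w0 = v /\ u1 = u0.
    move=> w0_pi u1_pi E.
    have /fset2P[->|ew] : w0 \in [fset v; u0] by rewrite -E fset21.
      split=> //; have /fset2P[ev|//] : u1 \in [fset v; u0] by rewrite -E fset22.
      by rewrite -ev u1_pi in v_pi.
    by rewrite ew u0_pi in w0_pi.
  have covered w0 u1 : [fset w0; u1] \in R -> w0 \in fcover R.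
    by move=> ?; apply/fcoverP; exists [fset w0; u1]; rewrite ?fset21.
  move=> w0 u1 u2 w0_pi u1_pi u2_pi.
  move=> /fset1UP[/inj[] // e1 ->|E1] /fset1UP[/inj[] // e2 e3|E2] //.
  - by rewrite -e1 (covered _ _ E2) in vR.
  - by rewrite -e2 (covered _ _ E1) in vR.
  - exact: QR E1 E2.
move=> u_pi u'_pi wR; have wG := fsubsetP (online_match_subset G pi tau) _ wR.
have [_ w_pi] := edge_sides wG u_pi.
exact: QR wR.
Qed.

(** Sending a covered vertex to an edge that contains it is injective, because no edge has both ends
    in [sigma]. *)
Lemma count_cover_online_match s tau : uniq s -> {subset s <= sigma} ->
  count (fun x => x \in fcover (online_match G pi tau)) s
    <= #|` online_match G pi tau|.
Proof.
set R := online_match G pi tau => us s_sigma.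
have RG e : e \in R -> e \in G by apply: fsubsetP; apply: online_match_subset.
rewrite -size_filter.
(* The implication makes the choice total; [fset0] is the default for the other vertices. *)
have ends (x : T) : exists e, (x \in s) && (x \in fcover R) ==> (e \in R) && (x \in e).
  have [/andP[_ /fcoverP[e eR xe]]|] := boolP (_ && _); last by exists fset0.
  by exists e; rewrite eR.
pose f x := xchoose (ends x).
have fP x : x \in filter (fun x => x \in fcover R) s -> (f x \in R) && (x \in f x).
  by rewrite mem_filter andbC; apply/implyP; exact: (xchooseP (ends x)).
rewrite -(size_map f) uniq_leq_size //; last first.
  by move=> e /mapP[x /fP/andP[fxR _] ->].
rewrite map_inj_in_uniq ?filter_uniq // => x y xs ys fxy.
have /andP[/RG eG xe] := fP _ xs; have /andP[_ ye] := fP _ ys.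
rewrite -fxy in ye; have [p /and3P[/eqP eE p1 _]] := edge_ends eG.
have [_ /(_ _ eG) not_sigma _] := G_bipartite.
have end1 z : z \in s -> z \in f x -> z = p.1.
  move=> /s_sigma z_sigma; rewrite eE => /fset2P[//|zp]; case/negP: not_sigma.
  by rewrite eE; apply/fsubsetP => z'; rewrite !inE => /orP[]/eqP-> //; rewrite -zp.
by move: xs ys; rewrite !mem_filter => /andP[_ /end1->] // /andP[_ /end1->].
Qed.

(* Moving v can only have helped the other offline vertices to stay free while
   v is unmatched, so the partner u of v still finds a candidate preceding v. *)
Lemma match_partner_before_foldl tau tau' v u s R R' :
  {subset sigma <= tau} ->
  (forall x y, x != v -> y != v ->
    (index x tau' <= index y tau') = (index x tau <= index y tau)) ->
  (forall x, x != v -> index x tau' <= index v tau' ->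
    index x tau <= index v tau') ->
  {subset s <= pi} ->
  (forall x, x != v -> x \notin pi -> x \in fcover R -> x \in fcover R') ->
  v \notin fcover (foldl (match_step G tau') R' s) ->
  u \in s -> [fset v; u] \in G ->
  exists2 w, [fset w; u] \in foldl (match_step G tau) R s
           & index w tau <= index v tau'.
Proof.
move=> sigma_tau same_order before + + + + vG.
elim: s R R' => //= u0 s IHs R R' sub inv v_free.
have u0_pi : u0 \in pi by rewrite sub ?mem_head.
have v_free1 : v \notin fcover (match_step G tau' R' u0).
  by apply: contra v_free; apply/fsubsetP/fcoverS/foldl_match_subset.
have v_free0 : v \notin fcover R'.
  by apply: contra v_free1; apply/fsubsetP/fcoverS/match_step_subset.
have [u0u|u0u] := eqVneq u u0.
  (* Under [tau'], [u] has the free neighbour [v] but leaves it free, so it takes some [w] preceding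
     [v]. By the invariant [w] is also free under [tau], where [u] therefore takes a vertex no later
     than [w]. *)
  move=> _; rewrite -u0u in u0_pi v_free1 *; clear IHs sub v_free.
  have [[/(_ _ vG)]|[w [wG wR' wmin E']]] := match_stepP G tau' R' u.
    by rewrite (negPf v_free0).
  have wv : w != v.
    apply: contraNneq v_free1 => <-.
    by rewrite E' in_fcoverU1 fset21.
  have [_ w_pi] := edge_sides wG u0_pi.
  have wR : w \notin fcover R by apply: contra wR'; apply: inv.
  have [[/(_ _ wG)]|[w' [wG' wR'' wmin' ->]]] := match_stepP G tau R u.
    by rewrite (negPf wR).
  exists w'.
    by apply: (fsubsetP (foldl_match_subset _ _ _ _)); rewrite fset1U1.
  apply: leq_trans (wmin' _ wG wR) _; apply: before => //; exact: wmin.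
rewrite inE (negPf u0u) /=; apply: IHs v_free.
  by move=> x xs; rewrite sub // inE xs orbT.
move=> x xv x_pi.
have [[_ ->]|[w [wG wR wmin ->]]] := match_stepP G tau R u0.
  by move=> /inv-/(_ xv x_pi); apply/fsubsetP/fcoverS/match_step_subset.
rewrite in_fcoverU1 => /orP[|/inv-/(_ xv x_pi)]; last first.
  by apply/fsubsetP/fcoverS/match_step_subset.
move=> /fset2P[xw|xu]; last by rewrite xu u0_pi in x_pi.
(* Remaining case of the invariant: [u0] takes [x] under [tau]. If [x] is still free under [tau'],
   then [u0] takes some [w] there; [x] and [w] are free in both runs, and the orders agree away from
   [v], so [w = x]. *)
rewrite -{w}xw in wG wR wmin *.
have [[/(_ _ wG) ? -> //]|[w [wG' wR' wmin' E']]] := match_stepP G tau' R' u0.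
rewrite E' in_fcoverU1.
have [//|xR'] := boolP (x \in fcover R'); first by rewrite orbT.
have wv : w != v.
  by apply: contraNneq v_free1 => <-; rewrite E' in_fcoverU1 fset21.
have [w_sigma w_pi] := edge_sides wG' u0_pi.
have [x_sigma _] := edge_sides wG u0_pi.
have wR0 : w \notin fcover R by apply: contra wR'; apply: inv.
have /index_inj -> : index x tau = index w tau; rewrite ?fset21 ?sigma_tau //.
by apply/eqP; rewrite eqn_leq wmin // -same_order // wmin'.
Qed.

(** Both runs start from the empty matching, where the invariant is vacuous, and [v] has index [t]
    in the moved list. *)
Lemma match_partner_before tau v u t : perm_eq tau sigma -> uniq sigma ->
  v \in sigma -> t < size sigma -> u \in pi -> [fset v; u] \in G ->
  v \notin fcover (online_match G pi (move v t tau)) ->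
  exists2 w, [fset w; u] \in online_match G pi tau & index w tau <= t.
Proof.
move=> tauP; rewrite -(perm_uniq tauP) -(perm_mem tauP) -(perm_size tauP).
move=> tau_uniq v_tau t_lt u_pi vG v_free.
have tv := index_move_self _ _ t_lt.
have := @match_partner_before_foldl tau (move v t tau) v u pi fset0 fset0.
rewrite tv //; apply=> //.
- by move=> x; rewrite (perm_mem tauP).
- by move=> x y xv yv; apply: leq_index_move.
- by move=> x xv; apply: index_before_move.
Qed.

End Matching.

(** * Double counting over edges and permutations *)

Section RankCounting.

Set Implicit Arguments.
Local Open Scope nat_scope.
Variables (T : choiceType) (G : {fset {fset T}}) (sigma pi : seq T).
Hypotheses (sigma_uniq : uniq sigma) (G_graph : is_graph G).
Hypothesis G_bipartite : bipartite G [fset v in sigma] [fset u in pi].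

Variables (P : seq (seq T)) (L : seq (T * T)).
Hypotheses (P_uniq : uniq P) (mem_P : forall s, (s \in P) = perm_eq s sigma).
Hypotheses (L1_uniq : uniq (unzip1 L)) (L2_uniq : uniq (unzip2 L)).
Hypothesis L_edges :
  {in L, forall p, [/\ [fset p.1; p.2] \in G, p.1 \in sigma & p.2 \in pi]}.

Let covered s x := x \in fcover (online_match G pi s).

(** Its mean over the permutations in [P] is the quantity [S t] of the recurrence. *)
Definition matched_below t s := count (fun x => (index x s < t) && covered s x) s.

Lemma matched_belowS t s : matched_below t.+1 s =
  matched_below t s + count (fun x => (index x s == t) && covered s x) s.
Proof.
rewrite /matched_below -[RHS]count_predUI [X in _ + X](@eq_count _ _ pred0) => [|x /=].
  rewrite count_pred0 addn0; apply: eq_count => x /=.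
  by rewrite -andb_orl ltnS orbC -leq_eqVlt.
by case: ltngtP => //= _; rewrite ?andbF.
Qed.

(** Each counted edge is charged to the partner [w] of its online end. As [w] has at most one online
    partner and the online ends in [L] are distinct, no [w] is charged twice. *)
Lemma count_partner_matched s t : s \in P ->
  count (fun p => has (fun w => (index w s < t) &&
                         ([fset w; p.2] \in online_match G pi s)) s) L
    <= matched_below t s.
Proof.
rewrite mem_P => sP; set R := online_match G pi s.
pose hit w (p : T * T) := (index w s < t) && ([fset w; p.2] \in R).
have -> : count (fun p => has (hit^~ p) s) L = \sum_(p <- L) has (hit^~ p) s.
  by rewrite -sum1_count big_mkcond /=; apply: eq_bigr => p _; case: has.
apply: (@leq_trans (\sum_(p <- L) \sum_(w <- s) hit w p)).
  apply: leq_sum => p _; rewrite has_count -sum1_count big_mkcond /=.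
  set c1 := BIG_F; rewrite (eq_bigr (fun w => hit w p : nat)); last first.
    by move=> w _; rewrite /c1; case: (hit w p).
  by case: (\sum_(w <- s) _).
rewrite exchange_big /matched_below -sum1_count [leqRHS]big_mkcond /=.
apply: leq_sum => w _; rewrite /hit; case: ltnP => _ /=; last by rewrite big1.
case: ifPn => [_|w_free].
  rewrite (eq_bigr (fun p : T * T => if [fset w; p.2] \in R then 1 else 0)); last first.
    by move=> p _; case: (_ \in R).
  rewrite -big_mkcond sum1_count.
  have -> : count (fun p : T * T => [fset w; p.2] \in R) L =
            count (fun u => [fset w; u] \in R) (unzip2 L) by rewrite count_map.
  apply: count_le1 => // u u' /mapP[p pL ->] /mapP[p' p'L ->].
  have [[_ _ u_pi] [_ _ u'_pi]] := (L_edges pL, L_edges p'L).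
  exact: (online_match_partner G_bipartite u_pi u'_pi).
rewrite big1 // => p _; case: (boolP (_ \in R)) => //= wR.
by case/fcoverP: w_free; exists [fset w; p.2]; rewrite ?fset21.
Qed.

(** This is the recurrence for [S t] multiplied through by the number of permutations. *)
Lemma sum_matched_belowS t : t < size sigma ->
  size L * size P + size sigma * \sum_(s <- P) matched_below t s
    <= (size sigma).+1 * \sum_(s <- P) matched_below t.+1 s.
Proof.
set m := size sigma => tm.
pose at_t s := count (fun x => (index x s == t) && covered s x) s.
have S_rec : \sum_(s <- P) matched_below t.+1 s =
    \sum_(s <- P) matched_below t s + \sum_(s <- P) at_t s.
  by rewrite -big_split; apply: eq_bigr => s _; apply: matched_belowS.
(* The sum of [at_t] is the increment from [t] to [t + 1], so this is a rearrangement of the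
   goal. *)
suff : size L * size P <=
    m * \sum_(s <- P) at_t s + \sum_(s <- P) matched_below t.+1 s.
  by have := congr1 (muln m) S_rec; rewrite mulSn mulnDr; lia.
have P_props v : v \in sigma -> {in P, forall s, [/\ uniq s, v \in s & size s = m]}.
  move=> v_sigma s; rewrite mem_P => sP.
  by rewrite (perm_uniq sP) (perm_mem sP) (perm_size sP).
have P_closed s s' : s \in P -> perm_eq s' s -> s' \in P.
  by rewrite !mem_P => sP s's; apply: perm_trans sP.
pose hit t s (p : T * T) :=
  has (fun w => (index w s < t) && ([fset w; p.2] \in online_match G pi s)) s.
have pair_bound : size L * size P <=
    \sum_(p <- L) (count (fun s => covered (move p.1 t s) p.1) P
                   + count (fun s => hit t.+1 s p) P).
  rewrite -sum1_size big_distrl /= !big_seq; apply: leq_sum => p pL.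
  (* For every permutation at least one of the two events occurs, so their union already counts all
     of [P]. *)
  rewrite mul1n -count_predUI; apply: leq_trans (leq_addr _ _).
  rewrite -{1}(count_predT P) -!sum1_count [leqRHS]big_mkcond !big_seq.
  apply: leq_sum => s; rewrite mem_P => sP /=.
  have [pG p1 p2] := L_edges pL.
  case: (boolP (covered _ _)) => //= v_free.
  have [w wR wt] := match_partner_before G_bipartite sP sigma_uniq p1 tm p2 pG v_free.
  suff -> : hit t.+1 s p by [].
  apply/hasP; exists w; last by rewrite ltnS wt.
  rewrite (perm_mem sP); have wG := fsubsetP (online_match_subset G pi s) _ wR.
  by have [] := edge_sides G_bipartite wG p2.
apply: leq_trans pair_bound _; rewrite big_split leq_add //=.
  (* Undoing the move costs the factor [m]; after exchanging the sums, the distinct offline ends in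
     [L] are among the elements of [s], which bounds the inner count by [at_t s]. *)
  apply: (@leq_trans (\sum_(p <- L)
      m * count (fun s => (index p.1 s == t) && covered s p.1) P)).
    rewrite !big_seq; apply: leq_sum => p pL; have [_ p1 _] := L_edges pL.
    exact: (@count_move _ P (covered^~ p.1) p.1 t m P_uniq P_closed (P_props _ p1) tm).
  rewrite -big_distrr leq_mul //=.
  rewrite (eq_bigr (fun p : T * T => \sum_(s <- P)
      if (index p.1 s == t) && covered s p.1 then 1 else 0)); last first.
    by move=> p _; rewrite -sum1_count big_mkcond.
  rewrite exchange_big /= !big_seq; apply: leq_sum => s; rewrite mem_P => sP.
  rewrite -big_mkcond sum1_count.
  rewrite -(count_map fst (fun v => (index v s == t) && covered s v)).
  apply: leq_count_subset => // _ /mapP[p pL ->].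
  by rewrite (perm_mem sP); have [] := L_edges pL.
rewrite (eq_bigr (fun p => \sum_(s <- P) if hit t.+1 s p then 1 else 0)); last first.
  by move=> p _; rewrite -sum1_count big_mkcond.
rewrite exchange_big /= !big_seq; apply: leq_sum => s sP.
rewrite -big_mkcond sum1_count; exact: count_partner_matched.
Qed.

Lemma matched_below_size s : s \in P ->
  matched_below (size sigma) s <= #|` online_match G pi s|.
Proof.
rewrite mem_P => sP.
apply: leq_trans (@count_cover_online_match _ _ _ _ G_graph G_bipartite s s _ _).
- by apply: sub_count => x /andP[].
- by rewrite (perm_uniq sP).
- by move=> x; rewrite (perm_mem sP).
Qed.

End RankCounting.

(** * Solving the recurrence and comparing the bounds *)

Section Recurrence.

Set Implicit Arguments.
Variable F : realFieldType.

(** In the induction step, the product of [1 - x] and [1 - k x] exceeds [1 - (k + 1) x] by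
    [k x^2]. *)
Lemma bernoulli (x : F) k : 0 <= x <= 1 -> 1 - k%:R * x <= (1 - x) ^+ k.
Proof.
move=> /andP[x0 x1]; elim: k => [|k IHk]; first by rewrite mul0r subr0 expr0.
rewrite exprS; apply: le_trans (ler_wpM2l _ IHk); last by rewrite subr_ge0.
have : 0 <= (k%:R : F) by rewrite ler0n.
rewrite -natr1; nra.
Qed.

Lemma ratio_power_step k :
  (1 - 1 / (k.+1%:R + 1)) ^+ k.+1 <= (1 - 1 / (k%:R + 1)) ^+ k :> F.
Proof.
(* The case 0 is separate because [q] would vanish there, and the argument cancels a factor [q]. *)
case: k => [|k]; first by rewrite expr0 expr1 gerBl divr_ge0 ?addr_ge0.
set a : F := k.+1%:R; have a1 : 1 <= a by rewrite ler1n.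
set q := 1 - 1 / (a + 1).
have -> : k.+2%:R = a + 1 :> F by rewrite natr1.
(* Chosen so that [1 - x] is the quotient of the two consecutive bases and [1 - (a + 1) x = q];
   Bernoulli with exponent [a + 1] then gives the claim. *)
set x := 1 / (a + 1) ^+ 2.
have x01 : 0 <= x <= 1.
  by rewrite /x divr_ge0 ?sqr_ge0 //= ler_pdivrMr ?exprn_gt0; nra.
have q_gt0 : 0 < q.
  have -> : q = a / (a + 1) by rewrite /q; field; lra.
  by rewrite divr_gt0; lra.
have qx : q = (1 - 1 / (a + 1 + 1)) * (1 - x).
  by rewrite /q /x; field; apply/andP; split; lra.
have := bernoulli k.+2 x01.
have -> : 1 - k.+2%:R * x = q.
  by rewrite -[k.+2%:R]natr1 -/a /q /x; field; lra.
move=> qle; rewrite -(ler_pM2l q_gt0) -exprS {2}qx exprMn mulrC.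
apply: ler_wpM2l qle; apply: exprn_ge0.
by rewrite subr_ge0 ler_pdivrMr; lra.
Qed.

Lemma ratio_power_nonincreasing n m : (n <= m)%N ->
  (1 - 1 / (m%:R + 1)) ^+ m <= (1 - 1 / (n%:R + 1)) ^+ n :> F.
Proof.
move=> nm; rewrite -(subnKC nm); elim: (m - n)%N => [|k IHk]; first by rewrite addn0.
by rewrite addnS; apply: le_trans (ratio_power_step _) IHk.
Qed.

Lemma recurrence_bound (n : F) m (S : nat -> F) :
  S 0%N = 0 ->
  (forall t, (t < m)%N -> n + m%:R * S t <= (m%:R + 1) * S t.+1) ->
  n * (1 - (1 - 1 / (m%:R + 1)) ^+ m) <= S m.
Proof.
move=> S0 S_rec; have m0 : (0 : F) <= m%:R by rewrite ler0n.
set q := 1 - 1 / (m%:R + 1).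
(* The recurrence says that the deficit [n - S t] shrinks by a factor of at least [q = m / (m + 1)]
   at each step. *)
suff decay t : (t <= m)%N -> n - S t <= n * q ^+ t.
  by have := decay m (leqnn m); rewrite mulrBr mulr1; lra.
elim: t => [|t IHt] tm; first by rewrite S0 subr0 expr0 mulr1.
have m1 : 0 < m%:R + 1 :> F by lra.
rewrite -(ler_pM2l m1) exprS.
have -> : (m%:R + 1) * (n * (q * q ^+ t)) = m%:R * (n * q ^+ t).
  by rewrite /q; field; lra.
have := ler_wpM2l m0 (IHt (ltnW tm)); have := S_rec _ tm; lra.
Qed.

End Recurrence.

(** * The expectation as an average over permutations *)

Section Expectation.

Set Implicit Arguments.

Lemma card_fset_count (K : choiceType) (A : {fset K}) (a : pred K) :
  #|` [fset x in A | a x]| = count a A.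
Proof.
rewrite -size_filter; apply/perm_size/uniq_perm => [||x].
- exact: fset_uniq.
- by rewrite filter_uniq ?fset_uniq.
- by rewrite mem_filter !inE /= andbC.
Qed.

Lemma expectation_RANKING (F : realFieldType) (T : choiceType) (V : {fset T}) G pi
    (f : {fset {fset T}} -> F) :
  expectation (RANKING F V G pi) f =
    (\sum_(tau <- perms V) f (online_match G pi tau)) / #|` perms V|%:R.
Proof.
rewrite /expectation.
(* The sum is extended from the support to all outputs, so that the permutations can be grouped by
   their output. *)
rewrite (big_fset_incl _ (finsupp_sub _ _ _)) => [|R _]; last first.
  by rewrite memNfinsupp => /eqP ->; rewrite mul0r.
rewrite [in RHS](@partition_big_imfset _ _ _ _ _ (online_match G pi)) /=.
rewrite big_distrl /= !big_seq; apply: eq_bigr => R R_im.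
rewrite fsfun_fun R_im card_fset_count mulrAC; congr (_ / _).
rewrite (eq_bigr (fun=> f R)) => [|tau /eqP -> //].
by rewrite big_const_seq iter_addr_0 mulr_natl.
Qed.

End Expectation.

(** * The competitive ratio *)

Theorem theorem3 (F : realFieldType) (T : choiceType)
    (G M : {fset {fset T}}) (sigma pi : seq T)
    (sigma_uniq : uniq sigma) (pi_uniq : uniq pi)
    (G_graph : is_graph G)
    (G_bipartite : bipartite G [fset v in sigma] [fset u in pi])
    (M_max : max_card_matching G M) (M_ge1 : (1 <= #|` M|)%N) :
  1 - (1 - 1 / (#|` M|%:R + 1)) ^+ #|` M|
    <= expectation (RANKING F [fset v in sigma] G pi) (fun R => #|` R|%:R)
         / #|` M|%:R.
Proof.
have [L [L_size L1_uniq L2_uniq L_edges]] :=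
  matching_ends G_graph G_bipartite (proj1 M_max).
rewrite expectation_RANKING.
set P := perms _; set n := #|` M|; pose m := size sigma.
have mem_P s : (s \in enum_fset P) = perm_eq s sigma.
  have -> : (s \in enum_fset P) = (s \in P) by [].
  rewrite !inE /= mem_permutations; apply/permPr: s.
  by apply: uniq_perm => //= x; rewrite !inE.
(* The edges of [M] have distinct offline ends, all in [sigma]. *)
have n_le_m : (n <= m)%N.
  rewrite /n -L_size -(size_map fst) uniq_leq_size // => _ /mapP[p pL ->].
  by have [] := L_edges _ pL.
have N_gt0 : 0 < #|` P|%:R :> F.
  by rewrite ltr0n cardfs_gt0; apply/fset0Pn; exists sigma; rewrite mem_P.
have n_gt0 : 0 < n%:R :> F by rewrite ltr0n.
pose S t : F := (\sum_(s <- P) matched_below G pi t s)%:R / #|` P|%:R.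
have S0 : S 0%N = 0.
  rewrite /S big1 ?mul0r // => s _.
  by rewrite /matched_below (eq_count (a2 := pred0)) ?count_pred0.
have S_rec t : (t < m)%N -> n%:R + m%:R * S t <= (m%:R + 1) * S t.+1.
  move=> tm; have := sum_matched_belowS sigma_uniq G_bipartite (fset_uniq P)
    mem_P L1_uniq L2_uniq L_edges tm.
  rewrite L_size -/n -/m -(ler_nat F) natrD !natrM -natr1 => le_sum.
  by rewrite -(ler_pM2r N_gt0) mulrDl -!mulrA mulVf ?gt_eqF // !mulr1.
have bound := recurrence_bound S0 S_rec.
rewrite ler_pdivlMr // mulrC.
apply: le_trans (le_trans bound _).
  (* Monotonicity replaces [m] by the smaller [n]; what remains is to bound [S m] by the expected
     size. *)
  by rewrite ler_pM2l // lerD2l lerN2 ratio_power_nonincreasing.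
rewrite /S ler_pM2r ?invr_gt0 // natr_sum !big_seq; apply: ler_sum => s sP.
rewrite ler_nat; apply: matched_below_size => //; exact: mem_P.
Qed.
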